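(* Let $n\ge 1$ and consider a time-homogeneous discrete-time Markov chain with states $1,2,\dots,n$. For states $i,j\in\{1,\dots,n\}$, let $Y_{ij}$ be the random variable representing the number of steps needed to move from $i$ to $j$ for the second time, and let $\psi_{ij}(z)$ be the probability generating function of the first passage time $X_{ij}$ from $i$ to $j$. Then the probability generating function of $Y_{ij}$ is $$\sum_{k\ge 1}P(Y_{ij}=k)\,z^k=\psi_{ij}(z)\,\psi_{jj}(z).$$
   Context: Let $(S_m)_{m\ge 0}$ be the Markov chain. For states $i,j$, the first passage time $X_{ij}$ is the number of steps needed to move from state $i$ to state $j$ for the first time, i.e. given $S_0=i$, $X_{ij}=\min\{m\ge 1: S_m=j\}$ (with $X_{ij}=\infty$ if there is no such $m$); in particular $X_{jj}$ is the first return time to $j$. The second passage time $Y_{ij}$ is, given $S_0=i$, the second smallest $m\ge 1$ with $S_m=j$ (with $Y_{ij}=\infty$ if there are fewer than two such $m$). The probability generating function of $X_{ij}$ is $\psi_{ij}(z)=\sum_{k=1}^{\infty}P(X_{ij}=k)z^k$. Identities between generating functions are understood as identities of formal power series in $z$ (equivalently, for all real $z$ with $|z|<1$). *)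

(* Defs.v *)
From mathcomp Require Import all_boot all_order all_algebra.
From mathcomp Require Import all_classical all_reals all_analysis.
Set Implicit Arguments.
Unset Strict Implicit.
Unset Printing Implicit Defensive.
Import Order.TTheory GRing.Theory Num.Theory.
Import numFieldNormedType.Exports.
Local Open Scope classical_set_scope.
Local Open Scope ring_scope.

Definition stochastic (R : realType) (n : nat) (p : 'M[R]_n) : Prop :=
  (forall x y, 0 <= p x y) /\ (forall x, \sum_y p x y = 1).

Definition cond_prob (R : realType) (d : measure_display)
    (T : measurableType d) (mu : probability T R) (A B : set T) : R :=
  fine (mu (A `&` B)) / fine (mu B).

(* Under [mu], S is a time-homogeneous Markov chain on 'I_n (which stands for
   {1, ..., n}) with transition matrix p, started at S_0 = i.  [cond_prob] is
   meaningful only for conditioning events of positive probability, hence the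
   guard in [markov_property]. *)
Record markov_chain_from (R : realType) (n : nat) (d : measure_display)
    (T : measurableType d) (p : 'M[R]_n) (mu : probability T R)
    (S : nat -> T -> 'I_n) (i : 'I_n) : Prop := MarkovChainFrom {
  markov_measurable : forall m x, measurable [set w | S m w = x];
  markov_start : mu [set w | S 0%N w = i] = 1%E;
  markov_property : forall (m : nat) (s : nat -> 'I_n),
    let past := [set w | forall l, (l <= m)%N -> S l w = s l] in
    (0 < mu past)%E ->
    cond_prob mu [set w | S m.+1 w = s m.+1] past = p (s m) (s m.+1) }.

(* Passage times are extended-real valued: the infimum of a nonempty set of
   naturals is its minimum, and the infimum of the empty set is +oo. *)
Definition first_passage (R : realType) (n : nat) (T : Type)
    (S : nat -> T -> 'I_n) (j : 'I_n) (w : T) : \bar R :=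
  ereal_inf [set m%:R%:E | m in [set m : nat | (1 <= m)%N /\ S m w = j]].

Definition second_passage (R : realType) (n : nat) (T : Type)
    (S : nat -> T -> 'I_n) (j : 'I_n) (w : T) : \bar R :=
  ereal_inf [set m%:R%:E | m in
    [set m : nat | [/\ (1 <= m)%N, S m w = j
                     & (first_passage R S j w < m%:R%:E)%E]]].

(* [X] takes values in {1, 2, ...} or +oo; the value +oo does not contribute.
   For |z| < 1 the series converges, its terms being at most |z| ^+ k in
   absolute value. *)
Definition pgf (R : realType) (d : measure_display) (T : measurableType d)
    (mu : probability T R) (X : T -> \bar R) (z : R) : R :=
  limn (fun N : nat =>
    \sum_(1 <= k < N) fine (mu [set w | X w = k%:R%:E]) * z ^+ k).

(* Generating function of the first passage time from i to j, where [P i] is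
   the law "given S_0 = i". *)
Definition psi (R : realType) (n : nat) (d : measure_display)
    (T : measurableType d) (P : 'I_n -> probability T R)
    (S : nat -> T -> 'I_n) (i j : 'I_n) (z : R) : R :=
  pgf (P i) (first_passage R S j) z.

(* Main.v *)
Require Import Defs.
From mathcomp Require Import all_boot all_order all_algebra.
From mathcomp Require Import all_classical all_reals all_analysis.
Import Order.TTheory GRing.Theory Num.Theory.
Import numFieldNormedType.Exports.
Local Open Scope classical_set_scope.
Local Open Scope ring_scope.

(* A path that returns to j for the second time at step k splits at its first
   visit to j, at some step 0 < a < k, into two blocks "avoid j, then hit j".
   Both passage times are therefore described by words constraining the
   successive positions, and the probability of such a word factorises at every
   letter that pins the position to j, so that
   P(Y_ij = k) = sum_a P(X_ij = a) P(X_jj = k - a).  The identity between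
   generating functions is then the Cauchy product of two absolutely convergent
   series. *)

Set Implicit Arguments.
Unset Strict Implicit.

(** * Cauchy products of absolutely convergent series *)

Definition cauchy_product {R : realType} (a b : R ^nat) : R ^nat :=
  fun k => \sum_(0 <= i < k.+1) a i * b (k - i)%N.

Lemma series_cauchy_product (R : realType) (a b : R ^nat) (N : nat) :
  series (cauchy_product a b) N =
  \sum_(0 <= i < N) a i * series b (N - i)%N.
Proof.
rewrite /series /= /cauchy_product.
under eq_big_nat => k /andP[_ kN].
  rewrite (big_nat_widen _ _ N) //; over.
rewrite (exchange_big_dep_nat predT) //=.
apply: eq_big_nat => i /andP[_ iN].
rewrite -(big_nat_widenl i 0 N predT (fun k => a i * b (k - i)%N)) //.
rewrite -[X in \sum_(X <= _ < _) _]add0n.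
rewrite big_addn mulr_sumr.
by apply: eq_bigr => k _; rewrite addnK.
Qed.

(** The product sums over the square [i, j < N], the Cauchy product over the triangle [i + j < N].
    Writing the difference as a sum over the remaining pairs allows a termwise triangle
    inequality. *)
Lemma seriesM_cauchy_product (R : realType) (a b : R ^nat) (N : nat) :
  series a N * series b N - series (cauchy_product a b) N =
  \sum_(0 <= i < N) a i * \sum_(N - i <= j < N) b j.
Proof.
rewrite series_cauchy_product mulr_suml -sumrB.
apply: eq_big_nat => i _; rewrite -mulrBr; congr (_ * _).
by rewrite /series /= (big_cat_nat _ (leq_subr i N)) /= ?leq0n // [X in X - _]addrC addrK.
Qed.

Lemma ler_seriesM_cauchy_product (R : realType) (a b : R ^nat) (N : nat) :
  (forall k, 0 <= a k) -> (forall k, 0 <= b k) ->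
  series (cauchy_product a b) N <= series a N * series b N.
Proof.
move=> a0 b0; rewrite -subr_ge0 seriesM_cauchy_product.
by apply: sumr_ge0 => i _; rewrite mulr_ge0 ?sumr_ge0.
Qed.

(** The triangle [i + j < 2 N] contains the square [i, j < N]. *)
Lemma ler_seriesM_cauchy_product_double (R : realType) (a b : R ^nat) (N : nat) :
  (forall k, 0 <= a k) -> (forall k, 0 <= b k) ->
  series a N * series b N <= series (cauchy_product a b) (N + N)%N.
Proof.
move=> a0 b0; rewrite series_cauchy_product (big_cat_nat _ (leq_addr N N)) //=.
apply: ler_wpDr.
  by apply: sumr_ge0 => i _; rewrite mulr_ge0 // sumr_ge0.
rewrite mulr_suml; apply: ler_sum_nat => i /andP[_ iN].
rewrite ler_wpM2l //; apply: nondecreasing_series => //.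
by rewrite -addnBA ?leq_addr // ltnW.
Qed.

(* For nonnegative series the partial products are squeezed between the
   partial sums of the Cauchy product at N and at 2 N; the error in the general
   case is dominated by the error for the absolute values. *)
Lemma cvg_cauchy_product (R : realType) (a b : R ^nat) :
  cvgn [normed series a] -> cvgn [normed series b] ->
  series (cauchy_product a b) @ \oo --> limn (series a) * limn (series b).
Proof.
move=> acvg bcvg.
pose a' k := `|a k|; pose b' k := `|b k|.
have a0 k : 0 <= a' k by rewrite /a'.
have b0 k : 0 <= b' k by rewrite /b'.
have sa0 N : 0 <= series a' N by exact: sumr_ge0.
have sb0 N : 0 <= series b' N by exact: sumr_ge0.
pose c' := series (cauchy_product a' b').
have c'nd : {homo c' : n m / (n <= m)%N >-> n <= m}.
  by apply: nondecreasing_series => n _ _; apply: sumr_ge0 => i _; rewrite mulr_ge0.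
have c'cvg : cvgn c'.
  apply: nondecreasing_is_cvgn => //.
  exists (limn (series a') * limn (series b')) => _ [N _ <-].
  apply: (le_trans (ler_seriesM_cauchy_product _ a0 b0)).
  by apply: ler_pM => //; apply: nondecreasing_cvgn_le => //;
     apply: nondecreasing_series.
pose D N := series a N * series b N - series (cauchy_product a b) N.
have D_to0 : D @ \oo --> 0.
  apply/norm_cvg0P.
  apply: (@squeeze_cvgr _ _ _ _ (cst 0) (fun N => limn c' - c' N)).
  - near=> N; rewrite normr_ge0 /=.
    apply: (@le_trans _ _ (series a' N * series b' N - c' N)).
      rewrite /D !seriesM_cauchy_product.
      apply: (le_trans (ler_norm_sum _ _ _)); apply: ler_sum => i _.
      by rewrite normrM ler_wpM2l // ler_norm_sum.
    rewrite lerD2r.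
    apply: (le_trans (ler_seriesM_cauchy_product_double _ a0 b0)).
    exact: nondecreasing_cvgn_le.
  - exact: cvg_cst.
  - rewrite -(subrr (limn c')); apply: cvgB => //; exact: cvg_cst.
have -> : series (cauchy_product a b) =
    (fun N => series a N * series b N - D N).
  by apply/funext => N; rewrite /D subKr.
rewrite -[X in _ --> X]subr0; apply: cvgB => //.
by apply: cvgM; exact: normed_cvg.
Unshelve. all: by end_near.
Qed.

(** * Words of constraints on successive positions, and their weights *)

Fixpoint follows {n : nat} {T : Type} (S : nat -> T -> 'I_n) (m : nat)
    (A : seq (pred 'I_n)) (w : T) : bool :=
  if A is a :: A' then a (S m w) && follows S m.+1 A' w else true.

(** The probability that a chain leaving [x] satisfies the letters of [A] at its next steps, as a
    sum over paths. *)
Fixpoint path_weight {R : realType} {n : nat} (p : 'M[R]_n) (x : 'I_n)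
    (A : seq (pred 'I_n)) : R :=
  if A is a :: A' then \sum_(y | a y) p x y * path_weight p y A' else 1.

Lemma follows_cat (n : nat) (T : Type) (S : nat -> T -> 'I_n) (m : nat)
    (A B : seq (pred 'I_n)) (w : T) :
  follows S m (A ++ B) w = follows S m A w && follows S (m + size A)%N B w.
Proof.
elim: A m => [|a A IH] m /=; first by rewrite addn0.
by rewrite IH andbA addSnnS.
Qed.

(* The chain forgets its history once its position is known to be j. *)
Lemma path_weight_cat_pred1 (R : realType) (n : nat) (p : 'M[R]_n)
    (x j : 'I_n) (A B : seq (pred 'I_n)) :
  path_weight p x (rcons A (pred1 j) ++ B) =
  path_weight p x (rcons A (pred1 j)) * path_weight p j B.
Proof.
elim: A x => [|a A IH] x /=; first by rewrite !big_pred1_eq mulr1.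
by rewrite mulr_suml; apply: eq_bigr => y _; rewrite IH mulrA.
Qed.

Lemma measure_partition_ord (R : realType) (n : nat) (d : measure_display)
    (T : measurableType d) (mu : probability T R) (X : T -> 'I_n) (E : set T)
    (a : pred 'I_n) :
  (forall x, measurable [set w | X w = x]) -> measurable E ->
  mu (E `&` [set w | a (X w)]) = (\sum_(y | a y) mu (E `&` [set w | X w = y]))%E.
Proof.
move=> mX mE.
rewrite -measure_bigsetU_ord_cond.
- congr (mu _); rewrite -bigcup_pred.
  apply/seteqP; split => [w [Ew aw]|w [y /= ay [Ew Xw]]]; first by exists (X w).
  by split => //=; rewrite Xw.
- by move=> y _; exact: measurableI.
- by move=> y z _ _ [w [[_ /= yE] [_ /= zE]]]; rewrite -yE -zE.
Qed.

(** * Probability of a word under the Markov chain *)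

Section Chain.
Variables (R : realType) (n : nat) (p : 'M[R]_n) (d : measure_display)
  (T : measurableType d) (mu : probability T R) (S : nat -> T -> 'I_n)
  (i : 'I_n).
Hypothesis HS : markov_chain_from p mu S i.

Let past (m : nat) (s : nat -> 'I_n) :=
  [set w | forall l, (l <= m)%N -> S l w = s l].

Lemma measurable_past m s : measurable (past m s).
Proof.
have mS := markov_measurable HS.
elim: m => [|m IH].
  rewrite (_ : past 0 s = [set w | S 0%N w = s 0%N]) //.
  apply/seteqP; split => [w|w /= h l]; first exact.
  by rewrite leqn0 => /eqP ->.
rewrite (_ : past m.+1 s = past m s `&` [set w | S m.+1 w = s m.+1]).
  exact: measurableI.
apply/seteqP; split => [w /= h|w /= [h1 h2] l].
  by split; [move=> l lm; apply: h; exact: leqW | exact: h].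
by rewrite leq_eqVlt => /orP[/eqP -> //|]; exact: h1.
Qed.

Lemma measurable_follows m A : measurable [set w | follows S m A w].
Proof.
have mS := markov_measurable HS.
elim: A m => [|a A IH] m /=; first by rewrite (_ : mkset _ = setT) //; apply/seteqP.
rewrite (_ : mkset _ = (\bigcup_(y in [set y | a y]) [set w | S m w = y]) `&`
   [set w | follows S m.+1 A w]).
  apply: measurableI => //; apply: fin_bigcup_measurable => //.
apply/seteqP; split => [w /= /andP[h1 h2]|w /= [[y /= ay ->] ->]].
  by split => //; exists (S m w).
by rewrite ay.
Qed.

(** The Markov property in multiplicative form needs no positivity guard: if the past is null, both
    sides vanish. *)
Lemma past_step m s :
  mu (past m s `&` [set w | S m.+1 w = s m.+1]) =
  (mu (past m s) * (p (s m) (s m.+1))%:E)%E.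
Proof.
have mE : measurable (past m s `&` [set w | S m.+1 w = s m.+1]).
  by apply: measurableI; [exact: measurable_past | exact: markov_measurable HS _ _].
have [mu0|mu0] := eqVneq (mu (past m s)) 0%E.
  rewrite mu0 mul0e; apply/eqP; rewrite eq_le measure_ge0 andbT -mu0.
  by apply: le_measure; rewrite ?inE //; exact: measurable_past.
have fP := fin_num_measure mu _ (measurable_past m s).
have := @markov_property _ _ _ _ _ _ _ _ HS m s; rewrite /= lt_neqAle measure_ge0 eq_sym mu0.
move=> /(_ isT) <-; rewrite /cond_prob setIC.
rewrite -[X in (X * _)%E]fineK // -EFinM mulrC divfK ?fineK //.
  by rewrite setIC fin_num_measure.
by rewrite fine_eq0.
Qed.

(** The Markov property conditions on complete trajectories, so the induction on [A] carries the
    whole past [s]: the first letter is split by the next position [y], which lengthens the past by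
    one step. *)
Lemma past_follows m s A :
  mu (past m s `&` [set w | follows S m.+1 A w]) =
  (mu (past m s) * (path_weight p (s m) A)%:E)%E.
Proof.
elim: A m s => [|a A IH] m s /=.
  by rewrite mule1; congr (mu _); apply/seteqP; split => // w [].
(* [s' y] prolongs [s] beyond time [m] by the value [y]. *)
pose s' y l := if (l <= m)%N then s l else y.
have past_s' y : past m (s' y) = past m s.
  by apply/seteqP; split => w /= h l lm; have := h l lm; rewrite /s' lm.
have pastS y : past m.+1 (s' y) = past m s `&` [set w | S m.+1 w = y].
  apply/seteqP; split => [w /= h|w /= [h1 h2] l].
    split; first by move=> l lm; have := h l (leqW lm); rewrite /s' lm.
    by have := h m.+1 (leqnn _); rewrite /s' ltnn.
  rewrite leq_eqVlt => /orP[/eqP -> |lm]; first by rewrite /s' ltnn.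
  by rewrite ltnS in lm; rewrite /s' lm h1.
have -> : past m s `&` [set w | a (S m.+1 w) && follows S m.+2 A w] =
    (past m s `&` [set w | follows S m.+2 A w]) `&` [set w | a (S m.+1 w)].
  apply/seteqP; split => [w /= [? /andP[]]|w /= [[? ?] ?]] //.
  by split => //; apply/andP.
rewrite measure_partition_ord; last 2 first.
- exact: markov_measurable HS _.
- by apply: measurableI; [exact: measurable_past | exact: measurable_follows].
have fP := fin_num_measure mu _ (measurable_past m s).
rewrite -(fineK fP) -EFinM mulr_sumr -sumEFin; apply: eq_bigr => y _.
have := IH m.+1 (s' y); rewrite pastS /s' ltnn => IHy.
have := past_step m (s' y); rewrite past_s' /s' leqnn ltnn -/s' => stepy.
by rewrite setIAC IHy stepy EFinM EFinM fineK // muleA.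
Qed.

Lemma measure_follows A :
  mu [set w | follows S 1 A w] = (path_weight p i A)%:E.
Proof.
have mS := markov_measurable HS.
pose s (_ : nat) := i.
have past0 : past 0 s = [set w | S 0%N w = i].
  apply/seteqP; split => [w /= h|w /= h l]; first exact: (h 0%N).
  by rewrite leqn0 => /eqP ->.
have := past_follows 0 s A; rewrite past0 (markov_start HS) mul1e => <-.
have mF := measurable_follows 1 A.
(* The part of the event outside [S_0 = i] lies in the complement of an event of probability 1. *)
rewrite (measureDI _ mF (mS 0%N i)) [X in (X + _)%E](_ : _ = 0%E) ?add0e 1?setIC //.
apply/eqP; rewrite eq_le measure_ge0 andbT.
apply: (@le_trans _ _ (mu (~` [set w | S 0%N w = i]))).
  by apply: le_measure; rewrite ?inE //; [exact: measurableD | exact: measurableC].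
by rewrite probability_setC // (markov_start HS) subee.
Qed.
End Chain.

(** * Passage times described by words *)

Lemma ereal_inf_nat (R : realType) (A : set nat) (k : nat) :
  ereal_inf [set m%:R%:E | m in A] = k%:R%:E :> \bar R <->
  A k /\ forall m, A m -> (k <= m)%N.
Proof.
have minE m : A m -> (forall l, A l -> (m <= l)%N) ->
    ereal_inf [set m%:R%:E | m in A] = m%:R%:E :> \bar R.
  move=> Am minm; apply/eqP; rewrite eq_le; apply/andP; split.
    by apply: ereal_inf_lbound; exists m.
  by apply/ereal_infP => _ [l Al <-]; rewrite lee_fin ler_nat minm.
split => [infE|[Ak mink]]; last exact: minE.
(* The infimum is finite, so [A] is nonempty and has a least element. *)
have exA : exists m, `[< A m >].
  apply: contrapT => A0.
  suff : ereal_inf [set m%:R%:E | m in A] = +oo%E :> \bar R by rewrite infE.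
  rewrite (_ : [set _ | _ in A] = set0) ?ereal_inf0 //.
  by apply/seteqP; split => // y [l Al _]; case: A0; exists l; exact/asboolP.
case: (ex_minnP exA) => l /asboolP Al minl.
have lmin q : A q -> (l <= q)%N by move=> /asboolP; exact: minl.
have := minE l Al lmin; rewrite infE => -[/eqP]; rewrite eqr_nat => /eqP ->.
by split.
Qed.

(** At [k = 0] this is the same word as at [k = 1], hence the assumption [0 < k] wherever it
    describes a passage. *)
Definition first_hit_word {n : nat} (j : 'I_n) (k : nat) : seq (pred 'I_n) :=
  rcons (nseq k.-1 (predC1 j : pred _)) (pred1 j).

(** The starting time [m] is arbitrary because the second block is read from the first visit
    onwards. *)
Lemma follows_first_hit_word (n : nat) (T : Type) (S : nat -> T -> 'I_n)
    (m k : nat) (j : 'I_n) (w : T) : (0 < k)%N ->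
  follows S m.+1 (first_hit_word j k) w <->
  S (m + k)%N w = j /\ forall l, (m < l < m + k)%N -> S l w <> j.
Proof.
case: k => // k _; rewrite /first_hit_word /=.
elim: k m => [|k IH] m /=.
  rewrite andbT addn1; split => [/eqP -> //|[-> //]].
  by split => // l; rewrite ltnS; case: ltngtP.
split => [/andP[/eqP Sj /IH]|[Sj h]].
  rewrite addSnnS => -[-> h]; split => // l /andP[].
  rewrite leq_eqVlt => /orP[/eqP <- //|ml lk]; apply: h; exact/andP.
apply/andP; split; first by apply/eqP; apply: h; rewrite ltnSn /= addnS ltnS addnS ltnS leq_addr.
by apply/IH; rewrite addSnnS; split => // l /andP[ml lk]; apply: h; rewrite (ltnW ml).
Qed.

Lemma first_passage_eqP (R : realType) (n : nat) (T : Type)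
    (S : nat -> T -> 'I_n) (j : 'I_n) (w : T) (k : nat) :
  first_passage R S j w = k%:R%:E <->
  [/\ (0 < k)%N, S k w = j & forall l, (0 < l < k)%N -> S l w <> j].
Proof.
rewrite /first_passage ereal_inf_nat; split => [[[k0 Sk] mink]|[k0 Sk h]].
  split => // l /andP[l0 lk] Sl; have := mink l (conj l0 Sl).
  by rewrite leqNgt lk.
split => // m [m0 Sm]; rewrite leqNgt; apply/negP => mk.
by apply: (h m) => //; rewrite m0.
Qed.

Lemma first_passage_follows (R : realType) (n : nat) (T : Type)
    (S : nat -> T -> 'I_n) (j : 'I_n) (w : T) (k : nat) : (0 < k)%N ->
  first_passage R S j w = k%:R%:E <-> follows S 1 (first_hit_word j k) w.
Proof.
move=> k0; rewrite first_passage_eqP follows_first_hit_word // add0n.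
by split => [[]|[]].
Qed.

(** With [a] the time of the first visit, minimality of [k] among later visits says that [j] is
    avoided strictly between [a] and [k]. *)
Lemma second_passage_eqP (R : realType) (n : nat) (T : Type)
    (S : nat -> T -> 'I_n) (j : 'I_n) (w : T) (k : nat) :
  second_passage R S j w = k%:R%:E <->
  exists a, [/\ (a < k)%N, first_passage R S j w = a%:R%:E &
    follows S a.+1 (first_hit_word j (k - a)) w].
Proof.
rewrite /second_passage ereal_inf_nat; split => [[[k0 Sk FPk] mink]|].
  (* Time [k] is itself a visit, so a first visit exists. *)
  have exS : exists m, (0 < m)%N && (S m w == j).
    by exists k; rewrite k0 Sk eqxx.
  case: (ex_minnP exS) => a /andP[a0 /eqP Sa] mina.
  have FPa : first_passage R S j w = a%:R%:E.
    apply/first_passage_eqP; split => // l /andP[l0 la] Sl.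
    by have := mina l; rewrite l0 Sl eqxx leqNgt la => /(_ isT).
  move: FPk mink; rewrite FPa lte_fin ltr_nat => ak mink.
  exists a; split => //; apply/follows_first_hit_word; first by rewrite subn_gt0.
  rewrite subnKC ?(ltnW ak) //; split => // l /andP[al lk] Sl.
  have /mink : [/\ (1 <= l)%N, S l w = j & (a%:R%:E < l%:R%:E :> \bar R)%E].
    by split => //; [exact: leq_ltn_trans al | rewrite lte_fin ltr_nat].
  by rewrite leqNgt lk.
move=> [a [ak FPa]]; rewrite FPa follows_first_hit_word ?subn_gt0 //.
rewrite subnKC ?(ltnW ak) // => -[Sk h]; split.
  by split => //; [exact: leq_ltn_trans ak | rewrite lte_fin ltr_nat].
move=> m [m0 Sm]; rewrite lte_fin ltr_nat => am; rewrite leqNgt; apply/negP => mk.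
by apply: (h m) => //; rewrite am.
Qed.

(** * Distributions and generating functions of the passage times *)

Lemma fine_prob_itv (R : realType) (d : measure_display) (T : measurableType d)
    (mu : probability T R) (A : set T) :
  measurable A -> 0 <= fine (mu A) <= 1.
Proof.
move=> mA; rewrite fine_ge0 // -lee_fin fineK ?fin_num_measure //.
exact: probability_le1.
Qed.

(** [series] starts at index 0 and [pgf] at 1; the extra term vanishes because [X] never takes the
    value 0. *)
Lemma pgf_series (R : realType) (d : measure_display) (T : measurableType d)
    (mu : probability T R) (X : T -> \bar R) (z : R) :
  (forall w, X w <> 0%:R%:E) ->
  pgf mu X z = limn (series (fun k => fine (mu [set w | X w = k%:R%:E]) * z ^+ k)).
Proof.
move=> X0; rewrite /pgf; congr (limn _); apply/funext => -[|N].
  by rewrite /series /= !big_geq.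
rewrite /series /= [RHS]big_ltn // (_ : [set w | X w = _] = set0).
  by rewrite measure0 mul0r add0r.
by apply/seteqP; split => // w /X0.
Qed.

Section PassageTimes.
Variables (R : realType) (n : nat) (p : 'M[R]_n) (d : measure_display)
  (T : measurableType d) (S : nat -> T -> 'I_n) (j : 'I_n).

Let FP k := [set w | first_passage R S j w = k%:R%:E].

Lemma first_passage_set0 : FP 0 = set0.
Proof. by apply/seteqP; split => // w /first_passage_eqP[]. Qed.

Lemma first_passage_set k : (0 < k)%N ->
  FP k = [set w | follows S 1 (first_hit_word j k) w].
Proof.
by move=> k0; rewrite /FP; apply/seteqP; split => w /=; rewrite first_passage_follows.
Qed.

Lemma prob_first_passage (mu : probability T R) (i : 'I_n) (k : nat) :
  markov_chain_from p mu S i -> (0 < k)%N ->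
  mu (FP k) = (path_weight p i (first_hit_word j k))%:E.
Proof. by move=> HS k0; rewrite first_passage_set // (measure_follows HS). Qed.

Lemma measurable_first_passage (mu : probability T R) (i : 'I_n) (k : nat) :
  markov_chain_from p mu S i -> measurable (FP k).
Proof.
move=> HS; case: k => [|k]; first by rewrite first_passage_set0.
by rewrite first_passage_set //; exact: measurable_follows HS _ _.
Qed.

(** The event is partitioned by the time of the first visit. The two blocks form one word, whose
    weight factorises at the first visit; the second factor is a first return probability under
    [nu]. *)
Lemma prob_second_passage (mu nu : probability T R) (i : 'I_n) (k : nat) :
  markov_chain_from p mu S i -> markov_chain_from p nu S j ->
  fine (mu [set w | second_passage R S j w = k%:R%:E]) =
  \sum_(0 <= a < k.+1) fine (mu (FP a)) * fine (nu (FP (k - a)%N)).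
Proof.
move=> HSi HSj.
(* Both blocks must be nonempty. At [a = 0] and [a = k] the event is empty, and the matching product
   vanishes since [FP 0] is empty. *)
pose E a := if (0 < a < k)%N then
  [set w | follows S 1 (first_hit_word j a ++ first_hit_word j (k - a)) w]
  else set0.
have EP a w : E a w <-> [/\ (a < k)%N, first_passage R S j w = a%:R%:E &
    follows S a.+1 (first_hit_word j (k - a)) w].
  rewrite /E; case: ifP => [/andP[a0 ak]|ak] /=.
    rewrite follows_cat size_rcons size_nseq prednK // add1n.
    split => [/andP[/(first_passage_follows R) ? ?] //|[_ ? ?]]; first by split; auto.
    by apply/andP; split => //; apply/(first_passage_follows R).
  split => // -[ka /first_passage_eqP[a0 _ _] _].
  by rewrite a0 ka in ak.
have -> : [set w | second_passage R S j w = k%:R%:E] =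
    \big[setU/set0]_(a < k.+1) E a.
  rewrite -bigcup_mkord; apply/seteqP; split => w.
    move=> /second_passage_eqP[a Ha]; exists a; last exact/EP.
    by case: Ha => ak _ _; exact: leqW.
  by move=> [a _ /EP Ha]; apply/second_passage_eqP; exists a.
have muE a : (a < k.+1)%N ->
    mu (E a) = (fine (mu (FP a)) * fine (nu (FP (k - a)%N)))%:E.
  move=> ak1; rewrite /E; case: ifP => [/andP[a0 ak]|ak].
    rewrite (measure_follows HSi) path_weight_cat_pred1.
    by rewrite (prob_first_passage HSi) // (prob_first_passage HSj) // subn_gt0.
  rewrite measure0; case: a ak1 ak => [|a] ak1 ak.
    by rewrite first_passage_set0 measure0 mul0r.
  have -> : (k - a.+1 = 0)%N by apply/eqP; rewrite subn_eq0 leqNgt; move: ak => /= ->.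
  by rewrite first_passage_set0 measure0 mulr0.
rewrite measure_bigsetU.
- rewrite (eq_bigr _ (fun (a : 'I_k.+1) _ => muE a (ltn_ord a))) sumEFin /=.
  by rewrite big_mkord.
- by move=> a; rewrite /E; case: ifP => // _; exact: measurable_follows HSi _ _.
- move=> a b _ _ [w [/EP[_ wa _] /EP[_ wb _]]].
  by move: wb; rewrite wa => -[/eqP]; rewrite eqr_nat => /eqP.
Qed.
End PassageTimes.

Unset Implicit Arguments.
Set Strict Implicit.

(* MathComp-Analysis *)
Theorem theorem5p1 (R : realType) (n : nat) (n_ge1 : (1 <= n)%N)
    (p : 'M[R]_n) (p_stochastic : stochastic p)
    (d : measure_display) (T : measurableType d)
    (P : 'I_n -> probability T R) (S : nat -> T -> 'I_n)
    (S_markov : forall i, markov_chain_from p (P i) S i)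
    (i j : 'I_n) (z : R) (z_lt1 : `|z| < 1) :
  pgf (P i) (second_passage R S j) z = psi P S i j z * psi P S j j z.
Proof.
rewrite /psi !pgf_series; last 3 first.
- by move=> w /first_passage_eqP[].
- by move=> w /first_passage_eqP[].
- by move=> w /second_passage_eqP[a []].
(* The coefficients are probabilities, so the geometric series of ratio [|z|] dominates. *)
have fcvg x : cvgn [normed series
    (fun k => fine (P x [set w | first_passage R S j w = k%:R%:E]) * z ^+ k)].
  apply: (@series_le_cvg _ _ (geometric 1 `|z|)) => [k|k|k|].
  - exact: normr_ge0.
  - by rewrite /= mul1r exprn_ge0.
  - rewrite /= mul1r normrM normrX ler_piMl ?exprn_ge0 //.
    have /andP[f0 f1] := fine_prob_itv (P x)
      (measurable_first_passage j k (S_markov x)).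
    by rewrite ger0_norm.
  - by apply: is_cvg_geometric_series; rewrite normr_id.
(* The product of limits becomes the limit of a Cauchy product, which leaves a termwise identity
   based on [z ^+ a * z ^+ (k - a) = z ^+ k]. *)
rewrite -(cvg_lim _ (cvg_cauchy_product (fcvg i) (fcvg j))) //.
congr (limn (series _)); apply/funext => k.
rewrite (prob_second_passage _ (S_markov i) (S_markov j)).
rewrite mulr_suml; apply: eq_big_nat => a /andP[_]; rewrite ltnS => ak.
by rewrite mulrACA -exprD subnKC.
Qed.
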